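(* If $G$ is a finite, simple, connected, uniquely dimensional graph of order $n$ containing a cycle, and $g$ is the girth of $G$, then $\beta(G)\leq n-g+1$.
   Context: For vertices $u,v$ of a connected graph $G$, $d(u,v)$ is the distance between them. For an ordered set $W=\{w_1,\dots,w_k\}\subseteq V(G)$ and $v\in V(G)$, $r(v|W)=(d(v,w_1),\dots,d(v,w_k))$. $W$ is a resolving set if distinct vertices have distinct representations $r(\cdot|W)$. A resolving set of minimum cardinality is a metric basis; its cardinality is the metric dimension $\beta(G)$. $G$ is uniquely dimensional if it has exactly one metric basis. The girth is the length of a shortest cycle. *)

(* Defs.v *)
From mathcomp Require Import all_boot.

Set Implicit Arguments.
Unset Strict Implicit.
Unset Printing Implicit Defensive.

(* A finite simple graph is a symmetric irreflexive relation e on a finType T. *)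

Section Graph.
Variables (T : finType) (e : rel T).

Definition connected_graph : Prop := forall x y : T, connect e x y.

Definition has_walk (x y : T) (n : nat) : bool :=
  [exists p : n.-tuple T, path e x p && (last x p == y)].

(* [find] on [iota 0 _] returns the least number satisfying the predicate;
   vertices joined by a walk are joined by one of length < #|T| (gdist_walk). *)
Definition gdist (x y : T) : nat := find (has_walk x y) (iota 0 #|T|).

(* Ordering W by [enum] loses nothing: whether the representations are
   pairwise distinct does not depend on the order chosen on W. *)
Definition metric_rep (W : {set T}) (v : T) : seq nat :=
  [seq gdist v w | w <- enum W].

Definition resolving (W : {set T}) : bool := injectiveb (metric_rep W).

(* The default [set: T] is resolving (resolvingT), so this is a true minimum. *)
Definition metric_dim : nat := #|[arg min_(W < [set: T] | resolving W) #|W|]|.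

Definition metric_basis (W : {set T}) : bool :=
  resolving W && (#|W| == metric_dim).

Definition uniquely_dimensional : Prop := exists! W : {set T}, metric_basis W.

(* The size condition excludes loops and edges traversed back and forth. *)
Definition graph_cycle (c : seq T) : bool := (2 < size c) && ucycleb e c.

Definition has_cycle : Prop := exists c : seq T, graph_cycle c.

(* A cycle has at most #|T| vertices; the value is #|T|.+1 on acyclic graphs. *)
Definition girth : nat :=
  find (fun n => [exists c : n.-tuple T, graph_cycle c]) (iota 0 #|T|.+1).

Lemma has_walkP x y n :
  reflect (exists p : seq T, [/\ path e x p, last x p = y & size p = n])
          (has_walk x y n).
Proof.
apply: (iffP existsP) => [[p /andP[ep /eqP lp]]|[p [ep lp sp]]].
  by exists p; rewrite size_tuple.
by move/eqP: sp => sp; exists (Tuple sp); rewrite /= ep lp eqxx.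
Qed.

Lemma find_iota0 (P : pred nat) N n : P n -> n < N ->
  P (find P (iota 0 N)) /\ find P (iota 0 N) <= n.
Proof.
move=> Pn ltnN.
have hP : has P (iota 0 N) by apply/hasP; exists n; rewrite ?mem_iota.
have lt_f : find P (iota 0 N) < N by rewrite has_find size_iota in hP.
split; first by have := nth_find 0 hP; rewrite nth_iota.
rewrite leqNgt; apply/negP => /(before_find 0).
by rewrite nth_iota // add0n Pn.
Qed.

Lemma gdist_le x p : path e x p -> gdist x (last x p) <= size p.
Proof.
case/shortenP=> q eq uq sq.
have szq : size q < #|T| by rewrite -/(size (x :: q)) -(card_uniqP uq) max_card.
have hq : has_walk x (last x q) (size q) by apply/has_walkP; exists q.
apply: leq_trans (find_iota0 hq szq).2 _.
by apply: uniq_leq_size sq; case/andP: uq.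
Qed.

Lemma gdist_walk x y : connect e x y -> has_walk x y (gdist x y).
Proof.
case/connectP=> p ep ->; case/shortenP: ep => q eq uq _.
have szq : size q < #|T| by rewrite -/(size (x :: q)) -(card_uniqP uq) max_card.
have hq : has_walk x (last x q) (size q) by apply/has_walkP; exists q.
exact: (find_iota0 hq szq).1.
Qed.

Lemma resolvingP (W : {set T}) :
  reflect (forall u v, {in W, forall w, gdist u w = gdist v w} -> u = v)
          (resolving W).
Proof.
rewrite /resolving; apply: (iffP (injectiveP (metric_rep W))) => inj u v.
  by move=> uv; apply: inj; apply/eq_in_map => w; rewrite mem_enum => /uv.
by move/eq_in_map=> uv; apply: inj => w wW; apply: uv; rewrite mem_enum.
Qed.

Lemma gdist0 x : gdist x x = 0.
Proof. by apply/eqP; rewrite -leqn0; apply: (@gdist_le x [::]). Qed.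

Lemma resolvingT : connected_graph -> resolving [set: T].
Proof.
move=> eC; apply/resolvingP => u v /(_ v (in_setT v)); rewrite gdist0 => d0.
have := gdist_walk (eC u v); rewrite d0.
by case/has_walkP=> p [_ <- /size0nil->].
Qed.

Lemma metric_dim_le (W : {set T}) : connected_graph -> resolving W -> metric_dim <= #|W|.
Proof.
by move=> eC rW; rewrite /metric_dim; case: arg_minnP; [apply: resolvingT|move=> ? _; apply].
Qed.

Lemma exists_metric_basis : connected_graph -> exists W : {set T}, metric_basis W.
Proof.
move=> eC; exists [arg min_(W < [set: T] | resolving W) #|W|].
by rewrite /metric_basis eqxx andbT; case: arg_minnP => //; apply: resolvingT.
Qed.

Lemma graph_cycle_size c : graph_cycle c -> size c <= #|T|.
Proof. by case/and3P=> _ _ uc; rewrite -(card_uniqP uc) max_card. Qed.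

Lemma girthP : has_cycle ->
  (exists2 c, graph_cycle c & size c = girth) /\
  (forall c, graph_cycle c -> girth <= size c).
Proof.
pose P n := [exists c : n.-tuple T, graph_cycle c].
have H c : graph_cycle c -> P girth /\ girth <= size c.
  move=> cc; apply: (@find_iota0 P); last by rewrite ltnS graph_cycle_size.
  by apply/existsP; exists (in_tuple c).
case=> c0 /H[/existsP[d dc] _]; split=> [|c /H[]//].
by exists d => //; rewrite size_tuple.
Qed.

(* So the subtraction [#|T| - girth] is never truncated on graphs with a cycle. *)
Lemma girth_le_order : has_cycle -> girth <= #|T|.
Proof. by move=> /girthP[[c /graph_cycle_size cT <-]]. Qed.

End Graph.

(* Main.v *)
(* A shortest cycle C is isometric, since two distinct simple paths with the same
   ends contain a cycle no longer than their total length. Hence any two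
   consecutive vertices x, y of C resolve C, and the complement of C together
   with x and y is a resolving set of size n - g + 2. Different edges of C give
   different such sets, so when the metric basis is unique these sets are not
   of minimum size. *)
Require Import Defs.
From mathcomp Require Import all_boot zify.

Set Implicit Arguments.
Unset Strict Implicit.
Unset Printing Implicit Defensive.

Section Graph.
Variables (T : finType) (e : rel T).
Hypotheses (e_sym : symmetric e) (e_conn : connected_graph e).

(** The last conjunct records that the reversed walk visits the same vertices as [x :: p]. *)
Lemma rev_path_last x p : path e x p ->
  exists q, [/\ path e (last x p) q, last (last x p) q = x, size q = size p &
                rcons (rev q) (last x p) = x :: p].
Proof.
move=> ep; exists (rev (belast x p)); split.
- by rewrite rev_path (eq_path (e' := e)) // => a b; rewrite e_sym.
- by case: p ep => //= y p _; rewrite rev_cons last_rcons.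
- by rewrite size_rev size_belast.
- by rewrite revK -lastI.
Qed.

Lemma gdistC x y : gdist e x y = gdist e y x.
Proof.
have le u v : gdist e u v <= gdist e v u.
  have /has_walkP[p [ep <- <-]] := gdist_walk (e_conn v u).
  have [q [eq lq <- _]] := rev_path_last ep.
  by rewrite -{2}lq; apply: gdist_le.
by apply/eqP; rewrite eqn_leq !le.
Qed.

Lemma gdist_eq0 x y : (gdist e x y == 0) = (x == y).
Proof.
apply/eqP/eqP=> [d0|->]; last exact: gdist0.
have := gdist_walk (e_conn x y); rewrite d0.
by case/has_walkP=> p [_ <- /size0nil->].
Qed.

(** Common first steps are stripped by induction. Once the first steps [a] and [b] differ, the rest
    of the two paths joins [a] to [b] without meeting [x], and a simple path extracted from it
    closes up through [x]. *)
Lemma two_paths_cycle x p q :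
    path e x p -> path e x q -> uniq (x :: p) -> uniq (x :: q) ->
    last x p = last x q -> p <> q ->
  exists2 c, graph_cycle e c & size c <= size p + size q.
Proof.
elim: p x q => [|a p IHp] x [|b q] //.
- by move=> _ _ _ /andP[xq _] /= lq; rewrite lq mem_last in xq.
- by move=> _ _ /andP[xp _] _ /= lp; rewrite -lp mem_last in xp.
move=> /andP[exa ep] /andP[exb eq] /andP[xp up] /andP[xq uq] /= lpq neq.
have [ab|nab] := eqVneq a b.
  subst b; have [||||||c cc sc] := IHp a q => //.
    by move=> pq; case: neq; rewrite pq.
  by exists c => //; lia.
have [q' [eq' lq' sq' rq']] := rev_path_last eq.
have sub z : z \in p ++ q' -> z \in (a :: p) ++ (b :: q).
  rewrite !mem_cat inE -rq' mem_rcons inE mem_rev.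
  by case/orP=> ->; rewrite !orbT.
have epq : path e a (p ++ q') by rewrite cat_path lpq; apply/andP.
have lst : last a (p ++ q') = b by rewrite last_cat lpq.
have sz : size (p ++ q') = size p + size q by rewrite size_cat sq'.
case/shortenP: epq lst => r er ur rs lr.
have xr : x \notin a :: r.
  apply/negP; rewrite inE => /orP[/eqP xa|/rs/sub].
    by rewrite xa mem_head in xp.
  by rewrite mem_cat (negPf xp) (negPf xq).
(* This gives the cycle [[:: x, a & r]] its third vertex. *)
have r0 : 0 < size r by case: (r) lr => //= ab; rewrite ab eqxx in nab.
have sr : size r <= size p + size q.
  by rewrite -sz; apply: uniq_leq_size rs; case/andP: ur.
exists [:: x, a & r]; last by rewrite /= addSn addnS !ltnS.
rewrite /graph_cycle /ucycleb [uniq _]/= xr; move: ur => /= ->.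
by rewrite rcons_path exa er lr e_sym exb !andbT.
Qed.

(** A strictly shorter walk would contain a simple path other than [p], and the two together would
    yield a cycle of length less than twice [size p], hence below the girth. *)
Lemma gdist_simple_path x p : has_cycle e -> path e x p -> uniq (x :: p) ->
  (size p).*2 <= girth e -> gdist e x (last x p) = size p.
Proof.
move=> cyc ep up sp; apply/eqP; rewrite eqn_leq gdist_le //= leqNgt.
apply/negP=> lt_d.
have /has_walkP[q [eq lq sq]] := gdist_walk (e_conn x (last x p)).
case/shortenP: eq lq => r er ur rs lr.
have sr : size r <= size q by apply: uniq_leq_size rs; case/andP: ur.
have [|c cc sc] := two_paths_cycle er ep ur up lr.
  by move=> rp; rewrite rp sq leqNgt lt_d in sr.
have := leq_trans sp (leq_trans ((girthP cyc).2 c cc) sc).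
by rewrite -addnn leq_add2r leqNgt (leq_ltn_trans sr) // sq.
Qed.

Lemma graph_cycle_rot n c : graph_cycle e (rot n c) = graph_cycle e c.
Proof. by rewrite /graph_cycle /ucycleb size_rot rot_cycle rot_uniq. Qed.

Lemma graph_cycle_rev c : graph_cycle e (rev c) = graph_cycle e c.
Proof.
rewrite /graph_cycle /ucycleb size_rev rev_cycle rev_uniq.
by rewrite (eq_cycle (e' := e)) // => a b; rewrite e_sym.
Qed.

(** The shorter of the two arcs has length at most half the girth, so it is a geodesic. Indices past
    the middle are reached along the reversed cycle. *)
Lemma gdist_girth_cycle x p i : graph_cycle e (x :: p) ->
    size (x :: p) = girth e -> i < girth e ->
  gdist e x (nth x (x :: p) i) = minn i (girth e - i).
Proof.
have half q j : graph_cycle e (x :: q) -> size (x :: q) = girth e ->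
    j.*2 <= girth e -> gdist e x (nth x (x :: q) j) = j.
  move=> cc sc lej.
  have cyc : has_cycle e by exists (x :: q).
  have /and3P[sc3 ec uc] := cc; rewrite /= in sc sc3.
  have stk : size (take j q) = j by rewrite size_takel //; lia.
  rewrite /= rcons_path in ec; case/andP: ec => eq _.
  have <- : last x (take j q) = nth x (x :: q) j.
    rewrite (last_nth x) stk; case: (j) lej => //= k lek.
    by rewrite nth_take.
  rewrite gdist_simple_path ?stk ?take_path //.
  by have := take_uniq j.+1 uc.
move=> cc sc lti.
have [lei|gti] := leqP i.*2 (girth e); first by rewrite half //; lia.
have i0 : 0 < i by lia.
have cc' : graph_cycle e (x :: rev p).
  by rewrite -graph_cycle_rev rev_cons revK -rot1_cons graph_cycle_rot.
have sc' : size (x :: rev p) = girth e by rewrite /= size_rev.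
have -> : nth x (x :: p) i = nth x (x :: rev p) (girth e - i).
  rewrite /= in sc; case: i {gti} i0 lti => // i _ lti.
  have -> : girth e - i.+1 = (size p - i.+1).+1 by lia.
  rewrite /= nth_rev; last by lia.
  by congr nth; lia.
by rewrite half //; lia.
Qed.

(** The distance to [x] determines the index [i] up to the reflection exchanging [i] and
    [girth e - i]; the distance to the neighbour [y] breaks this symmetry. *)
Lemma girth_cycle_resolved x y s u v : graph_cycle e [:: x, y & s] ->
    size [:: x, y & s] = girth e ->
    u \in [:: x, y & s] -> v \in [:: x, y & s] ->
    gdist e u x = gdist e v x -> gdist e u y = gdist e v y ->
  u = v.
Proof.
move=> cc sc.
have dy i : i < girth e -> gdist e y (nth x [:: x, y & s] i) =
    if i == 0 then 1 else minn i.-1 (girth e - i.-1).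
  case: i => [_|i lti].
    by rewrite gdistC -[y]/(nth x [:: x, y & s] 1) gdist_girth_cycle //;
      move: sc cc => /= <- /and3P[]; lia.
  (* Rotating the cycle to start at [y] lowers every index by one, except that of [x], which moves
     to the end. *)
  have cc' : graph_cycle e (y :: rcons s x).
    by rewrite -rcons_cons -rot1_cons graph_cycle_rot.
  have sc' : size (y :: rcons s x) = girth e by rewrite /= size_rcons.
  have -> : nth x [:: x, y & s] i.+1 = nth y (y :: rcons s x) i.
    rewrite /= in sc; rewrite -rcons_cons nth_rcons /=.
    by rewrite ifT; [apply: set_nth_default => /= | ]; lia.
  by rewrite gdist_girth_cycle //; lia.
move=> /(nthP x)[i lti <-] /(nthP x)[j ltj <-].
rewrite sc in lti ltj.
rewrite ![gdist e (nth _ _ _) _]gdistC !dy // !gdist_girth_cycle //.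
move=> dx dy'; congr nth.
by case: i j lti ltj dx dy' => [|i] [|j] /=; lia.
Qed.

(** Members of the set are told apart from all other vertices by their distance 0 to themselves. The
    remaining vertices lie on the cycle, where [x] and [y] suffice. *)
Lemma resolving_girth_cycle x y s : graph_cycle e [:: x, y & s] ->
    size [:: x, y & s] = girth e ->
  resolving e (~: [set z in s]).
Proof.
move=> cc sc; apply/resolvingP => u v duv.
have [uW|] := boolP (u \in ~: [set z in s]).
  by have /esym/eqP := duv u uW; rewrite gdist0 gdist_eq0 => /eqP.
have [vW|] := boolP (v \in ~: [set z in s]).
  by have /eqP := duv v vW; rewrite gdist0 gdist_eq0 => /eqP.
rewrite !inE !negbK => vs us.
have /and3P[_ _ /= /and3P[]] := cc; rewrite inE negb_or => /andP[_ xs] ys _.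
by apply: (girth_cycle_resolved cc sc); rewrite ?inE ?us ?vs ?orbT // duv // !inE.
Qed.

Lemma card_setC_girth_cycle x y s : graph_cycle e [:: x, y & s] ->
  size [:: x, y & s] = girth e -> #|~: [set z in s]| = #|T| - girth e + 2.
Proof.
move=> cc sc; have := graph_cycle_size cc.
have /and3P[_ _ /= /and3P[_ _ us]] := cc.
by rewrite cardsCs setCK cardsE (card_uniqP us); move: sc => /=; lia.
Qed.

End Graph.

Theorem theorem2 (T : finType) (e : rel T)
    (e_sym : symmetric e) (e_irr : irreflexive e)
    (e_conn : connected_graph e)
    (e_uniq : uniquely_dimensional e)
    (e_cycle : has_cycle e) :
  metric_dim e <= #|T| - girth e + 1.
Proof.
rewrite leqNgt; apply/negP => gt_dim.
(* Under the negated bound, a resolving set of size n - g + 2 has minimum size. *)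
have basis x y s : graph_cycle e [:: x, y & s] -> size [:: x, y & s] = girth e ->
    metric_basis e (~: [set z in s]).
  move=> cc sc; have rW := resolving_girth_cycle e_sym e_conn cc sc.
  have := metric_dim_le e_conn rW.
  rewrite /metric_basis rW (card_setC_girth_cycle cc sc) eqn_leq => ->.
  by rewrite -addn1 -addnA in gt_dim; rewrite gt_dim.
have [[[|x [|y [|z s]]] // cc sc] _] := girthP e_cycle.
(* Rotation by one replaces the edge xy by yz. The two resulting bases differ at [x], which belongs
   only to the first. *)
have cc' : graph_cycle e [:: y, z & rcons s x].
  by rewrite -!rcons_cons -rot1_cons graph_cycle_rot.
have sc' : size [:: y, z & rcons s x] = girth e by rewrite /= size_rcons.
have [W [_ W_unique]] := e_uniq.
have /setP/(_ x) : ~: [set w in z :: s] = ~: [set w in rcons s x].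
  by rewrite -(W_unique _ (basis _ _ _ cc sc)) (W_unique _ (basis _ _ _ cc' sc')).
have /and3P[_ _ /= /andP[xs _]] := cc.
by move: xs; rewrite !inE mem_rcons mem_head !negb_or => /and3P[_ -> ->].
Qed.
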